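(* Let $n\ge 5$. Among all sets of $n$ distinct points on the sphere $S^2$, the minimum number of orderings is $2n$, and a set of $n$ points attains exactly $2n$ orderings if and only if its points lie on a common circle of $S^2$ (the intersection of $S^2$ with a plane) and are equally spaced along that circle.
   Context: Distances on $S^2$ are geodesic. For a finite set $S\subset S^2$ and a vantage point $V\in S^2$, order $S$ by $P<Q$ iff the geodesic distance from $V$ to $P$ is less than that to $Q$; vantage points producing ties are ignored. The number of orderings of $S$ is the number of distinct orderings so obtained; equivalently, the number of connected components of the complement in $S^2$ of the union of the bisecting great circles $\{X\in S^2: d(X,P)=d(X,Q)\}$ of all pairs $P\ne Q$ in $S$. *)

(* Defs.v *)
From mathcomp Require Import all_boot all_order all_algebra.
From mathcomp Require Import finmap.
From mathcomp Require Import all_classical all_reals all_analysis.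

Set Implicit Arguments.
Unset Strict Implicit.
Unset Printing Implicit Defensive.

Import Order.TTheory GRing.Theory Num.Theory.

Local Open Scope classical_set_scope.
Local Open Scope ring_scope.

(* The library norm on 'rV[R]_3 is the sup norm, so the Euclidean structure
   is given by the explicit dot product. *)
Definition dot (R : realType) (x y : 'rV[R]_3) : R := \sum_i x 0 i * y 0 i.

Definition sphere2 (R : realType) : set 'rV[R]_3 := [set x | dot x x = 1].

(* Great-circle distance; meaningful for points of [sphere2]. *)
Definition geodist (R : realType) (x y : 'rV[R]_3) : R := acos (dot x y).

Definition tie_free (R : realType) (S : {fset 'rV[R]_3}) (V : 'rV[R]_3) : Prop :=
  forall P Q : S, P != Q -> geodist V (val P) != geodist V (val Q).

(* The strict order on S seen from V, as the set of pairs (P, Q) with P < Q. *)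
Definition ordering_from (R : realType) (S : {fset 'rV[R]_3}) (V : 'rV[R]_3) :
    {set S * S} :=
  [set PQ : S * S | geodist V (val PQ.1) < geodist V (val PQ.2)]%SET.

Definition num_orderings (R : realType) (S : {fset 'rV[R]_3}) : nat :=
  #|[set o : {set S * S} |
      `[< exists V : 'rV[R]_3,
            [/\ sphere2 V, tie_free S V & o = ordering_from S V] >] ]%SET|.

Definition is_circle (R : realType) (C : set 'rV[R]_3) : Prop :=
  exists (a : 'rV[R]_3) (b : R),
    a != 0 /\ C = sphere2 (R := R) `&` [set x | dot a x = b].

Definition circle_point (R : realType) (c u v : 'rV[R]_3) (r t : R) :
    'rV[R]_3 :=
  c + r *: (cos t *: u + sin t *: v).

(* [circle_point c u v r] parametrizes C proportionally to arc length (u, v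
   orthonormal), and S is the set of the points of C at the #|S| parameters
   t0 + 2 k pi / #|S|. *)
Definition equally_spaced (R : realType) (C : set 'rV[R]_3)
    (S : {fset 'rV[R]_3}) : Prop :=
  exists (c u v : 'rV[R]_3) (r t0 : R),
    [/\ 0 < r,
        [/\ dot u u = 1, dot v v = 1 & dot u v = 0],
        C = range (circle_point c u v r) &
        [set` S] =
          [set circle_point c u v r (t0 + 2 * pi * k%:R / #|` S|%:R)
             | k in [set k : nat | (k < #|` S|)%N]] ].

(* Main.v *)
(* The orderings of S are the regions cut out of space by the planes through 0
   normal to the differences P - Q of points of S.  A plane not parallel to the
   previous ones adds at least two regions, and at least four if its normal is
   independent of two previous normals.

   No three points of a sphere are collinear, so the differences Q - P from a
   fixed P have n - 1 distinct directions.  If S is not coplanar they contain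
   three independent vectors, which gives at least 2 + 2 + 4 + 4 + 2 (n - 5)
   = 2 n + 2 regions.

   If S lies on a circle at angles t_k (increasing, t_(k+n) = t_k + 2 pi), then
   the chord P_i P_j is orthogonal to the direction (t_i + t_j) / 2, so regions
   are counted by the sums t_i + t_j mod 2 pi.  For each b the n sums
     t_b + t_(b+1) < ... < t_b + t_(b+n-1) < t_(b+1) + t_(b+n-1)
   fit in a period, hence 2 n orderings; if there are no more than that, every
   other sum is equal to one of these modulo 2 pi, and comparing first
   t_(b+1) + t_(b+n-2), then t_(b+2) + t_(b+n-2), makes consecutive gaps equal. *)

Require Import Defs.
From mathcomp Require Import all_boot all_order all_algebra.
From mathcomp Require Import finmap.
From mathcomp Require Import all_classical all_reals all_analysis.
From mathcomp Require Import zify ring lra.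

Set Implicit Arguments.
Unset Strict Implicit.
Unset Printing Implicit Defensive.

Import Order.TTheory GRing.Theory Num.Theory.

Local Open Scope classical_set_scope.
Local Open Scope ring_scope.

Lemma uniq_map_inj_in (T1 T2 : eqType) (f : T1 -> T2) (s : seq T1) :
  uniq [seq f x | x <- s] -> {in s &, injective f}.
Proof.
elim: s => //= a s IH /andP[fa /IH inj] x y; rewrite !in_cons.
move=> /orP[/eqP->|xs] /orP[/eqP->|ys] // e; last exact: inj.
- by move: fa; rewrite e map_f.
- by move: fa; rewrite -e map_f.
Qed.

(** * Dot and cross products in three-space *)

Section Space.
Variable R : realType.
Implicit Types (x y z h k V W X : 'rV[R]_3) (L M : seq 'rV[R]_3).

Lemma rv3P x y : x 0 0 = y 0 0 -> x 0 1 = y 0 1 -> x 0 2%:R = y 0 2%:R -> x = y.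
Proof.
move=> e0 e1 e2; apply/rowP => -[[|[|[|//]]] Hi].
- by rewrite (_ : Ordinal Hi = 0) //; exact/val_inj.
- by rewrite (_ : Ordinal Hi = 1) //; exact/val_inj.
- by rewrite (_ : Ordinal Hi = 2%:R) //; exact/val_inj.
Qed.

Lemma dotE x y :
  dot x y = x 0 0 * y 0 0 + x 0 1 * y 0 1 + x 0 2%:R * y 0 2%:R.
Proof.
rewrite /dot !big_ord_recl big_ord0 addr0 addrA.
congr (_ + _ + _); congr (x 0 _ * y 0 _); exact/val_inj.
Qed.

Lemma dotC x y : dot x y = dot y x.
Proof. by rewrite !dotE; ring. Qed.

Lemma dotDl x y z : dot (x + y) z = dot x z + dot y z.
Proof. by rewrite !dotE !mxE; ring. Qed.

Lemma dotZl (a : R) x z : dot (a *: x) z = a * dot x z.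
Proof. by rewrite !dotE !mxE; ring. Qed.

Lemma dotNl x z : dot (- x) z = - dot x z.
Proof. by rewrite !dotE !mxE; ring. Qed.

Lemma dotDr x y z : dot z (x + y) = dot z x + dot z y.
Proof. by rewrite !dotE !mxE; ring. Qed.

Lemma dotZr (a : R) x z : dot z (a *: x) = a * dot z x.
Proof. by rewrite !dotE !mxE; ring. Qed.

Lemma dotNr x z : dot z (- x) = - dot z x.
Proof. by rewrite !dotE !mxE; ring. Qed.

Lemma dot0l x : dot 0 x = 0.
Proof. by rewrite !dotE !mxE; ring. Qed.

Lemma dot_ge0 x : 0 <= dot x x.
Proof. by rewrite dotE; nra. Qed.

Lemma dot_eq0 x : (dot x x == 0) = (x == 0).
Proof.
apply/eqP/eqP => [|->]; last exact: dot0l.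
by rewrite dotE => e; apply: rv3P; rewrite !mxE; nra.
Qed.

Lemma dot_gt0 x : x != 0 -> 0 < dot x x.
Proof. by move=> x0; rewrite lt_neqAle dot_ge0 eq_sym dot_eq0 x0. Qed.

Definition cross x y : 'rV[R]_3 :=
  \row_i [:: x 0 1 * y 0 2%:R - x 0 2%:R * y 0 1;
             x 0 2%:R * y 0 0 - x 0 0 * y 0 2%:R;
             x 0 0 * y 0 1 - x 0 1 * y 0 0]`_i.

Definition det3 x y z : R := dot x (cross y z).

Lemma dot_crossl x y : dot x (cross x y) = 0.
Proof. by rewrite dotE !mxE /=; ring. Qed.

Lemma dot_crossr x y : dot y (cross x y) = 0.
Proof. by rewrite dotE !mxE /=; ring. Qed.

Lemma crossC x y : cross x y = - cross y x.
Proof. by apply: rv3P; rewrite !mxE /=; ring. Qed.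

Lemma cross0l y : cross 0 y = 0.
Proof. by apply: rv3P; rewrite !mxE /=; ring. Qed.

Lemma dot_cross_self x y :
  dot (cross x y) (cross x y) = dot x x * dot y y - dot x y ^+ 2.
Proof. by rewrite !dotE !mxE /=; ring. Qed.

Lemma cross_cross x y : cross x (cross x y) = dot x y *: x - dot x x *: y.
Proof. by apply: rv3P; rewrite !mxE !dotE /=; ring. Qed.

(** Cramer's rule: the determinant times [h] is a combination of cross products whose coefficients
    are the dot products of [h] with [x], [y], [z]. *)
Lemma det3_orth x y z h : det3 x y z != 0 ->
  dot h x = 0 -> dot h y = 0 -> dot h z = 0 -> h = 0.
Proof.
move=> D hx hy hz.
have E : det3 x y z *: h =
    dot h x *: cross y z + dot h y *: cross z x + dot h z *: cross x y.
  by apply: rv3P; rewrite /det3 !(dotE, mxE) /=; ring.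
move: E; rewrite hx hy hz !scale0r !addr0 => /eqP.
by rewrite scaler_eq0 (negPf D) => /eqP.
Qed.

(** By Lagrange's identity [dot_cross_self], the squared length of the cross product is 1 minus the
    square of [dot x y]. *)
Lemma cauchy_schwarz x y : dot x x = 1 -> dot y y = 1 -> -1 <= dot x y <= 1.
Proof.
move=> xx yy; have := dot_ge0 (cross x y); rewrite dot_cross_self xx yy => H.
by apply/andP; split; nra.
Qed.

(** A line meets the sphere at most twice: if [Q = P + h] and [T = P + l *: h] are unit vectors,
    subtracting [l] times the first norm equation from the second leaves
    [l * (l - 1) * dot h h = 0]. *)
Lemma sphere_no3collinear P Q T : dot P P = 1 -> dot Q Q = 1 -> dot T T = 1 ->
  P != Q -> P != T -> Q != T -> cross (Q - P) (T - P) != 0.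
Proof.
move=> PP QQ TT PQ PT QT; apply/eqP => C0.
have [h hE] : exists h, h = Q - P by exists (Q - P).
have [k kdef] : exists k, k = T - P by exists (T - P).
rewrite -hE -kdef in C0.
have hh : 0 < dot h h by apply: dot_gt0; rewrite hE subr_eq0 eq_sym.
have kE : k = (dot h k / dot h h) *: h.
  have := cross_cross h k; rewrite C0 crossC cross0l oppr0 => /eqP.
  rewrite eq_sym subr_eq0 => /eqP e.
  by rewrite mulrC -scalerA e scalerA mulVf ?scale1r // gt_eqF.
move: kE; move: (_ / _) => l kE.
have QE : Q = P + h by rewrite hE addrC subrK.
have TE : T = P + l *: h by rewrite -kE kdef addrC subrK.
move: QQ TT; rewrite {1 2}QE {1 2}TE !(dotDl, dotDr, dotZl, dotZr) (dotC h P) PP.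
move=> e1 e2; have : l * (l - 1) * dot h h = 0 by nra.
move/eqP; rewrite !mulf_eq0 (gt_eqF hh) orbF subr_eq0 => /orP[]/eqP l0.
- by move: PT; rewrite TE l0 scale0r addr0 eqxx.
- by move: QT; rewrite TE l0 scale1r -QE eqxx.
Qed.

(** * Regions of a central arrangement of planes *)

(** For a [generic] vector this sign vector identifies the region that contains it. *)
Definition signs L V : seq bool := [seq 0 < dot V h | h <- L].

Definition generic L V := {in L, forall h, dot V h != 0}.

(** Regions are open: each normal allows steps up to a positive bound, and the least bound serves
    all of [L]. The [+ 1] in [b] keeps the denominator positive. *)
Lemma signs_small_move L V W : generic L V ->
  exists2 e : R, 0 < e & forall d, `|d| <= e ->
    generic L (V + d *: W) /\ signs L (V + d *: W) = signs L V.
Proof.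
elim: L => [|h L IH] g; first by exists 1.
have [|e e0 He] := IH; first by move=> k kL; apply: g; rewrite in_cons kL orbT.
have a0 : 0 < `|dot V h| by rewrite normr_gt0 g // mem_head.
pose b := `|dot W h| + 1; have b0 : 0 < b by rewrite ltr_wpDl.
exists (Num.min e (`|dot V h| / (2 * b))).
  by rewrite lt_min e0 divr_gt0 // mulr_gt0.
move=> d; rewrite le_min => /andP[de db].
have [gL sL] := He d de.
have dW : `|d * dot W h| < `|dot V h|.
  rewrite normrM; rewrite ler_pdivlMr ?mulr_gt0 // in db.
  have := normr_ge0 d; have := normr_ge0 (dot W h); rewrite /b in db; nra.
have Eh : (dot (V + d *: W) h != 0) /\ (0 < dot (V + d *: W) h) = (0 < dot V h).
  rewrite dotDl dotZl; move: dW; rewrite ltr_norml.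
  have := g h (mem_head _ _); case: (ltrgt0P (dot V h)) => // sV _ /andP[d1 d2].
  - by have H : 0 < dot V h + d * dot W h; [lra|rewrite gt_eqF // H].
  - have H : dot V h + d * dot W h < 0 by lra.
    by rewrite lt_eqF // ltNge ltW.
split; last by rewrite /= Eh.2 sL.
by move=> k; rewrite in_cons => /orP[/eqP->|/gL//]; exact: Eh.1.
Qed.

(* Taking [h = 0] gives unrestricted perturbations. *)
Lemma perturb h L M V : generic L V -> dot V h = 0 ->
  {in M, forall m, exists W, dot W h = 0 /\ dot W m != 0} ->
  exists V', [/\ generic L V', generic M V', signs L V' = signs L V & dot V' h = 0].
Proof.
move=> gL Vh; elim: M => [|m M IH] HM; first by exists V; split.
have [|V1 [g1 g1M s1 V1h]] := IH.
  by move=> k kM; apply: HM; rewrite in_cons kM orbT.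
have [V1m|V1m] := eqVneq (dot V1 m) 0; last first.
  exists V1; split=> // k; rewrite in_cons => /orP[/eqP->|/g1M] //.
have [W [Wh Wm]] := HM m (mem_head _ _).
(* Including [M] here keeps [V1] generic for the normals of [M] already treated. *)
have [|e e0 He] := @signs_small_move (L ++ M) V1 W.
  by move=> k; rewrite mem_cat => /orP[/g1|/g1M].
have [|g s] := He e; first by rewrite gtr0_norm.
exists (V1 + e *: W); split.
- by move=> k kL; apply: g; rewrite mem_cat kL.
- move=> k; rewrite in_cons => /orP[/eqP->|kM].
    by rewrite dotDl dotZl V1m add0r mulf_neq0 // gt_eqF.
  by apply: g; rewrite mem_cat kM orbT.
- move: s; rewrite /signs !map_cat => /eqP.
  by rewrite eqseq_cat ?size_map // => /andP[/eqP-> _].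
- by rewrite dotDl dotZl V1h Wh mulr0 addr0.
Qed.

Lemma perturb_free L M V : generic L V -> 0 \notin M ->
  exists V', [/\ generic L V', generic M V' & signs L V' = signs L V].
Proof.
move=> gL M0; have [|m mM|V' [g1 g2 s _]] := @perturb 0 L M V gL.
- by rewrite dotC dot0l.
- exists m; split; first by rewrite dotC dot0l.
  by rewrite dot_eq0; apply: contraNneq M0 => <-.
- by exists V'.
Qed.

Lemma perturb_plane h L M V : generic L V -> dot V h = 0 ->
  {in M, forall m, cross h m != 0} ->
  exists V', [/\ generic L V', generic M V', signs L V' = signs L V & dot V' h = 0].
Proof.
move=> gL Vh HM; apply: perturb => // m /HM C.
(* Up to a negative factor this is the projection of [m] to the plane normal to [h]; its dot product
   with [m] is minus the squared length of [cross h m]. *)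
exists (cross h (cross h m)); split; first by rewrite dotC dot_crossl.
rewrite cross_cross dotDl dotNl !dotZl.
have := dot_gt0 C; rewrite dot_cross_self => H.
by rewrite -oppr_eq0 gt_eqF //; lra.
Qed.

(** A lower bound for the number of regions, given by one representative in each of [N] distinct
    regions. *)
Definition regions_ge L (N : nat) := exists Vs : seq 'rV[R]_3,
  [/\ size Vs = N, {in Vs, forall V, generic L V} & uniq [seq signs L V | V <- Vs]].

(* A region met by the plane normal to [h] is cut in two by that plane. *)
Lemma regions_ge_cut h L N (Xs : seq 'rV[R]_3) : h != 0 -> regions_ge L N ->
  {in Xs, forall X, generic L X /\ dot X h = 0} ->
  uniq [seq signs L X | X <- Xs] -> regions_ge (h :: L) (N + size Xs).
Proof.
move=> h0 [Vs [sVs gVs uVs]] HXs uXs.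
(* The old representatives are pushed off the new plane inside their regions. *)
have [Vs' [sVs' gVs' EVs']] : exists Vs', [/\ size Vs' = size Vs,
    {in Vs', forall V, generic (h :: L) V} &
    [seq signs L V | V <- Vs'] = [seq signs L V | V <- Vs]].
  elim: Vs gVs {sVs uVs} => [|V Vs IH] gVs; first by exists [::].
  have [|Vs' [s g e]] := IH; first by move=> W WVs; apply: gVs; rewrite in_cons WVs orbT.
  have [||V' [g1 g2 s12]] := @perturb_free L [:: h] V.
  - by apply: gVs; rewrite mem_head.
  - by rewrite inE eq_sym.
  exists (V' :: Vs'); split; rewrite /= ?s ?e ?s12 //.
  move=> W; rewrite in_cons => /orP[/eqP->|/g//] k.
  by rewrite in_cons => /orP[/eqP->|/g1//]; apply: g2; rewrite mem_head.
(* Each [X] on the new plane gives a new representative, chosen among the two nearby points on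
   either side of the plane. *)
have [Ys [sYs gYs EYs nYs]] : exists Ys, [/\ size Ys = size Xs,
    {in Ys, forall V, generic (h :: L) V},
    [seq signs L V | V <- Ys] = [seq signs L V | V <- Xs] &
    {in Ys, forall Y, signs (h :: L) Y \notin [seq signs (h :: L) V | V <- Vs']}].
  elim: Xs HXs {uXs} => [|X Xs IH] HXs; first by exists [::].
  have [|Ys [s g e nY]] := IH; first by move=> W WXs; apply: HXs; rewrite in_cons WXs orbT.
  have [gX Xh] := HXs X (mem_head _ _).
  have [e0 e00 He] := signs_small_move h gX.
  have hh := dot_gt0 h0.
  have [[gp sp] [gm sm]] : (generic L (X + e0 *: h) /\ signs L (X + e0 *: h) = signs L X)
     /\ (generic L (X + (- e0) *: h) /\ signs L (X + (- e0) *: h) = signs L X).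
    by split; apply: He; rewrite ?normrN gtr0_norm.
  have dp : 0 < dot (X + e0 *: h) h by rewrite dotDl dotZl Xh add0r mulr_gt0.
  have dm : dot (X + (- e0) *: h) h < 0.
    by rewrite dotDl dotZl Xh add0r mulNr oppr_lt0 mulr_gt0.
  suff [Y [gY sY nYY]] : exists Y, [/\ generic (h :: L) Y, signs L Y = signs L X &
      signs (h :: L) Y \notin [seq signs (h :: L) V | V <- Vs']].
    exists (Y :: Ys); split; rewrite /= ?s ?e ?sY //.
    - by move=> W; rewrite in_cons => /orP[/eqP->|/g//].
    - by move=> W; rewrite in_cons => /orP[/eqP->|/nY//].
  have gcons Y : dot Y h != 0 -> generic L Y -> generic (h :: L) Y.
    by move=> Yh gY k; rewrite in_cons => /orP[/eqP->|/gY].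
  (* Both sides cannot be represented in [Vs'] already: the two representatives would agree on [L],
     hence coincide, yet have opposite signs at [h]. *)
  have [/mapP[V VVs /= [Es1 Es2]]|np] := boolP
      (signs (h :: L) (X + e0 *: h) \in [seq signs (h :: L) V | V <- Vs']); last first.
    by exists (X + e0 *: h); split => //; apply: gcons; rewrite ?gt_eqF.
  exists (X + (- e0) *: h); split => //; first by apply: gcons; rewrite ?lt_eqF.
  apply/negP => /mapP[V1 V1Vs /= [Es3 Es4]].
  have uV : {in Vs' &, injective (signs L)} by apply: uniq_map_inj_in; rewrite EVs'.
  have E : V = V1.
    apply: uV => //; rewrite -[LHS]Es2 -[RHS]Es4; congruence.
  by move: Es1; rewrite E -Es3 dp ltNge ltW.
exists (Vs' ++ Ys); split; first by rewrite size_cat sVs' sVs sYs.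
- by move=> V; rewrite mem_cat => /orP[/gVs'|/gYs].
(* [behead] forgets the sign at [h], so sign vectors that differ on [L] still differ on [h :: L]. *)
have lift Zs : uniq [seq signs L V | V <- Zs] -> uniq [seq signs (h :: L) V | V <- Zs].
  rewrite -(_ : [seq behead s | s <- [seq signs (h :: L) V | V <- Zs]] = [seq signs L V | V <- Zs]).
    exact: map_uniq.
  by rewrite -map_comp.
rewrite map_cat cat_uniq !lift ?EVs' ?EYs // andbT /=.
by apply/hasPn => _ /mapP[Y YYs ->]; exact: nYs.
Qed.

End Space.

(** * Region counts for growing families of planes, and their transfer to orderings *)

Section Orderings.
Variable R : realType.
Implicit Types (h V W X x y : 'rV[R]_3) (L M : seq 'rV[R]_3) (S : {fset 'rV[R]_3}).

Lemma eq_signs L V W h : signs L V = signs L W -> h \in L ->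
  (0 < dot V h) = (0 < dot W h).
Proof. by move/eq_in_map => E hL; exact: (E h hL). Qed.

(** Allows regions to be told apart by the signs at a few chosen normals. *)
Lemma uniq_signs_sub (K L Xs : seq 'rV[R]_3) : {subset K <= L} ->
  uniq [seq signs K X | X <- Xs] -> uniq [seq signs L X | X <- Xs].
Proof.
move=> KL uK; rewrite map_inj_in_uniq ?(map_uniq uK) // => X Y XX YX E.
apply: (uniq_map_inj_in uK) => //; apply/eq_in_map => k /KL.
exact: eq_signs.
Qed.

Lemma regions_ge1 h : h != 0 -> regions_ge [:: h] 2.
Proof.
(* The empty arrangement has one region; 0 represents it and lies on the new plane. *)
move=> h0; apply: (@regions_ge_cut _ h [::] 1 [:: 0]) => //.
- by exists [:: 0].
- by move=> X; rewrite inE => /eqP->; split=> //; exact: dot0l.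
Qed.

Lemma cross_neq0 h k : cross h k != 0 -> h != 0.
Proof. by apply: contraNneq => ->; rewrite cross0l. Qed.

(** The new plane contains a point [X] off all the old planes; [X] and [- X] lie in different
    regions, so at least two regions are cut. *)
Lemma regions_ge_cut2 h L N : L != [::] -> {in L, forall k, cross h k != 0} ->
  regions_ge L N -> regions_ge (h :: L) (N + 2).
Proof.
case: L => // k L _ HL HN.
have [|||X [_ gX _ Xh]] := @perturb_plane R h [::] (k :: L) 0 => //.
  exact: dot0l.
have Xk := gX k (mem_head _ _).
apply: (regions_ge_cut (Xs := [:: X; - X])) => //.
- by apply: cross_neq0 (HL k (mem_head _ _)).
- move=> Y; rewrite !inE => /orP[]/eqP-> //; split; last by rewrite dotNl Xh oppr0.
  by move=> m /gX; rewrite dotNl oppr_eq0.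
rewrite /= andbT inE eqseq_cons negb_and dotNl oppr_gt0.
by case: ltrgt0P Xk.
Qed.

(** The planes of [k1] and [k2] trace two distinct lines on the plane of [h]. The four sectors
    between them lie in different regions, and each such region is cut. *)
Lemma regions_ge_cut4 h k1 k2 L N : det3 h k1 k2 != 0 -> k1 \in L -> k2 \in L ->
  {in L, forall k, cross h k != 0} ->
  regions_ge L N -> regions_ge (h :: L) (N + 4).
Proof.
move=> D k1L k2L HL HN.
pose K := [:: k1; k2].
have [s12 s11 s22 s21] : [/\ dot (cross h k1) k2 = det3 h k1 k2, dot (cross h k1) k1 = 0,
    dot (cross h k2) k2 = 0 & dot (cross h k2) k1 = - det3 h k1 k2].
  by rewrite /det3; split; rewrite !(dotE, mxE) /=; ring.
have Xex (a b : bool) : exists X,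
    [/\ generic L X, dot X h = 0, (0 < dot X k1) = a & (0 < dot X k2) = b].
  pose D' : R := det3 h k1 k2.
  (* The term in [cross h k1] vanishes on [k1], so the sign at [k1] comes from [cross h k2], and
     conversely; both dot products are the square of [D'] up to the prescribed sign. *)
  pose X := ((-1) ^+ (~~ b) * D') *: cross h k1 - ((-1) ^+ (~~ a) * D') *: cross h k2.
  have X1 : dot X k1 = (-1) ^+ (~~ a) * (D' * D').
    by rewrite dotDl dotNl !dotZl s11 s21 -/D'; ring.
  have X2 : dot X k2 = (-1) ^+ (~~ b) * (D' * D').
    by rewrite dotDl dotNl !dotZl s12 s22 -/D'; ring.
  have DD : 0 < D' * D' by rewrite lt_neqAle eq_sym mulf_neq0 // -expr2 sqr_ge0.
  have sgnP (c : bool) : (0 < (-1) ^+ (~~ c) * (D' * D')) = c.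
    by case: c; rewrite ?expr0 ?expr1 ?mul1r // mulN1r oppr_gt0 ltNge ltW.
  have [|| |X' [_ gX' sX' X'h]] := @perturb_plane R h K L X.
  - by move=> k; rewrite !inE => /orP[]/eqP->; rewrite ?X1 ?X2 mulf_neq0 ?signr_eq0 ?gt_eqF.
  - by rewrite dotC dotDr dotNr !dotZr !dot_crossl !mulr0 subr0.
  - exact: HL.
  exists X'; split=> //.
  - by rewrite (eq_signs sX') ?inE ?eqxx // X1 sgnP.
  - by rewrite (eq_signs sX') ?inE ?eqxx ?orbT // X2 sgnP.
have [X1 [g1 h1 a1 b1]] := Xex true true.
have [X2 [g2 h2 a2 b2]] := Xex true false.
have [X3 [g3 h3 a3 b3]] := Xex false true.
have [X4 [g4 h4 a4 b4]] := Xex false false.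
apply: (regions_ge_cut (Xs := [:: X1; X2; X3; X4])) => //.
- exact: cross_neq0 (HL k1 k1L).
- by move=> X; rewrite !inE => /or4P[]/eqP->.
apply: (@uniq_signs_sub K); first by move=> k; rewrite !inE => /orP[]/eqP->.
by rewrite /= a1 a2 a3 a4 b1 b2 b3 b4.
Qed.

Lemma regions_ge_cat L0 L N : L0 != [::] -> regions_ge L0 N ->
  pairwise (fun h k => cross h k != 0) (L ++ L0) ->
  regions_ge (L ++ L0) (N + 2 * size L).
Proof.
move=> L00 HN; elim: L => [|h L IH] /=; first by rewrite muln0 addn0.
move=> /andP[/allP hL /IH HL].
rewrite mulnS [(2 + _)%N]addnC addnA; apply: regions_ge_cut2 => //.
by move: L00; case: (L0) (L) => // ? ? [].
Qed.

(** The last normal alone gives two regions and each further one adds two. *)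
Lemma regions_ge_pencil L : L != [::] -> 0 \notin L ->
  pairwise (fun h k => cross h k != 0) L -> regions_ge L (2 * size L).
Proof.
case/lastP: L => // L h _ L0 pL.
rewrite size_rcons -cats1 mulnS; apply: regions_ge_cat; rewrite ?cats1 //.
apply: regions_ge1; apply: contraNneq L0 => <-.
by rewrite mem_rcons mem_head.
Qed.

(** [acos] is decreasing. Comparing distances from [V] thus amounts to the sign of [dot V (Q - P)],
    which links orderings to [signs]. *)
Lemma ltr_geodist V P Q : dot V V = 1 -> dot P P = 1 -> dot Q Q = 1 ->
  (geodist V P < geodist V Q) = (dot V Q < dot V P).
Proof.
move=> V1 P1 Q1; have cP := cauchy_schwarz V1 P1; have cQ := cauchy_schwarz V1 Q1.
rewrite /geodist -[in RHS](acosK (x := dot V Q)) ?in_itv //.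
rewrite -[in RHS](acosK (x := dot V P)) ?in_itv //.
by rewrite ltr_cos // in_itv /= acos_ge0 ?acos_lepi.
Qed.

Lemma geodist_eq V P Q : dot V V = 1 -> dot P P = 1 -> dot Q Q = 1 ->
  (geodist V P == geodist V Q) = (dot V P == dot V Q).
Proof.
move=> V1 P1 Q1; rewrite !eq_le !leNgt !ltr_geodist // andbC.
by [].
Qed.

Lemma mem_ordering_from S V (P Q : S) : [set` S] `<=` sphere2 (R := R) ->
  dot V V = 1 ->
  ((P, Q) \in ordering_from S V) = (dot V (val Q) < dot V (val P)).
Proof. by move=> SS V1; rewrite inE /= ltr_geodist //; apply: SS; exact: valP. Qed.

(** The sign at [P - Q] tells which of [P] and [Q] is nearer, so vantage points with different sign
    vectors on [L] induce different orderings. *)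
Lemma num_orderings_ge S L N : [set` S] `<=` sphere2 (R := R) -> L != [::] ->
  {in L, forall h, exists P Q, [/\ P \in S, Q \in S, P != Q & h = P - Q]} ->
  regions_ge L N -> (N <= num_orderings S)%N.
Proof.
move=> SS L0 HL [Vs [<- gVs uVs]] {N}.
(* All differences, not only those in [L]: being generic for [M] means being tie free. *)
pose M : seq 'rV[R]_3 := [seq val p.1 - val p.2 | p <- enum {: S * S} & p.1 != p.2].
have M0 : 0 \notin M.
  apply/mapP => -[[P Q]]; rewrite mem_filter /= => /andP[PQ _] /esym/eqP.
  by rewrite subr_eq0 => /eqP/val_inj e; rewrite e eqxx in PQ.
(* The representatives are made generic for [M] and then scaled to unit length by a positive factor,
   which keeps all signs. *)
have [Ws [sWs gWs EWs]] : exists Ws, [/\ size Ws = size Vs,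
    {in Ws, forall W, dot W W = 1 /\ generic M W} &
    [seq signs L V | V <- Ws] = [seq signs L V | V <- Vs]].
  elim: Vs gVs {uVs} => [|V Vs IH] gVs; first by exists [::].
  have [|Ws [s g e]] := IH; first by move=> W WVs; apply: gVs; rewrite in_cons WVs orbT.
  have [||V' [g1 g2 s12]] := @perturb_free R L M V => //.
    by apply: gVs; rewrite mem_head.
  have V'0 : 0 < dot V' V'.
    apply: dot_gt0; case: (L) L0 g1 => // h ? _ /(_ h (mem_head _ _)).
    by apply: contraNneq => ->; rewrite dot0l.
  pose a := (Num.sqrt (dot V' V'))^-1.
  have a0 : 0 < a by rewrite invr_gt0 sqrtr_gt0.
  exists (a *: V' :: Ws); split; rewrite /= ?s ?e -?s12 //.
    move=> W; rewrite in_cons => /orP[/eqP->|/g//]; split.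
      rewrite dotZl dotZr mulrA -expr2 exprVn sqr_sqrtr ?ltW // mulVf //.
      by rewrite gt_eqF.
    by move=> k kM; rewrite dotZl mulf_neq0 ?g2 // gt_eqF.
  by congr (_ :: _); apply/eq_map => k; rewrite dotZl pmulr_rgt0.
rewrite -sWs -EWs {sWs EWs Vs gVs} in uVs *.
have memM (P Q : S) : P != Q -> val P - val Q \in M.
  by move=> PQ; apply/mapP; exists (P, Q); rewrite // mem_filter PQ mem_enum.
rewrite /num_orderings cardE -(size_map (ordering_from S)).
apply: uniq_leq_size.
  rewrite map_inj_in_uniq ?(map_uniq uVs) // => V W VW WW E.
  apply: (uniq_map_inj_in uVs) => //; apply/eq_in_map => h hL.
  have [P [Q [PS QS PQ ->]]] := HL h hL.
  have [V1 _] := gWs V VW; have [W1 _] := gWs W WW.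
  have /setP/(_ ([` PS], [` QS])%fset) := E.
  by rewrite !mem_ordering_from //= !dotDr !dotNr !subr_gt0.
move=> _ /mapP[V VW ->]; have [V1 gV] := gWs V VW.
rewrite mem_enum inE; apply/asboolP; exists V; split => // P Q PQ.
rewrite geodist_eq //; [|apply: SS; exact: valP..].
have := gV _ (memM P Q PQ).
by rewrite dotDr dotNr subr_eq0.
Qed.

End Orderings.

(** * Non-coplanar sets *)

Section NonCoplanar.
Variable R : realType.
Implicit Types (h V W X x y : 'rV[R]_3) (L M : seq 'rV[R]_3) (S : {fset 'rV[R]_3}).

Lemma pairwise_cross_sphere P (Ts : seq 'rV[R]_3) :
  {in P :: Ts, forall Q, dot Q Q = 1} -> uniq (P :: Ts) ->
  pairwise (fun h k => cross h k != 0) [seq Q - P | Q <- Ts].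
Proof.
move=> sT /=/andP[PT uT]; rewrite pairwise_map.
have [P1 T1] : dot P P = 1 /\ {in Ts, forall Q, dot Q Q = 1}.
  by split=> [|Q QT]; apply: sT; rewrite in_cons ?eqxx ?QT ?orbT.
move: uT; rewrite uniq_pairwise.
apply: (sub_in_pairwise (P := mem Ts)); last exact/allP.
move=> Q U QT UT QU; have nP V : V \in Ts -> P != V.
  by move=> VT; apply: contraNneq PT => ->.
by apply: sphere_no3collinear => //; [exact: T1|exact: T1|exact: nP|exact: nP].
Qed.

Lemma noncoplanar_orderings S : [set` S] `<=` sphere2 (R := R) ->
  (5 <= #|` S|)%N ->
  ~ (exists a b, a != 0 /\ {in S, forall P, dot a P = b}) ->
  (2 * #|` S| + 2 <= num_orderings S)%N.
Proof.
move=> SS; pose s0 : seq 'rV[R]_3 := enum_fset S.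
have pick1 (s : seq 'rV[R]_3) : (0 < size s)%N -> exists P, P \in s.
  by case: s => // P s _; exists P; rewrite mem_head.
rewrite (_ : #|` S| = size s0) // => S5 NC.
have [P /perm_to_rem Ps] : exists P, P \in s0 by apply: pick1; lia.
move: (rem _ _) Ps => s1 E1.
have z1 := perm_size E1; rewrite /= in z1; rewrite z1 in S5.
have [Q1 /perm_to_rem Ps] : exists Q, Q \in s1 by apply: pick1; lia.
move: (rem _ _) Ps => s2 E2.
have z2 := perm_size E2; rewrite /= in z2; rewrite z2 in S5.
have [Q2 /perm_to_rem Ps] : exists Q, Q \in s2 by apply: pick1; lia.
move: (rem _ _) Ps => s3 E3.
have z3 := perm_size E3; rewrite /= in z3; rewrite z3 in S5.
have E13 : perm_eq s0 [:: P, Q1, Q2 & s3].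
  apply: (perm_trans E1); rewrite perm_cons; apply: (perm_trans E2).
  by rewrite perm_cons.
have u0 : uniq s0 by exact: fset_uniq.
have sph : {in s0, forall Q, dot Q Q = 1} by move=> Q Qs; exact: SS.
have C12 : cross (Q1 - P) (Q2 - P) != 0.
  have := @pairwise_cross_sphere P [:: Q1, Q2 & s3].
  rewrite -(perm_uniq E13) u0 => /(_ _ isT) /=.
  by case/(_ _)/andP => [Q|/andP[]//]; rewrite -(perm_mem E13); exact: sph.
(* Otherwise all of [S] lies in the plane through [P], [Q1], [Q2]. *)
have [Q3 Q3s D3] : exists2 Q, Q \in s3 & dot (cross (Q1 - P) (Q2 - P)) (Q - P) != 0.
  apply: contrapT => H; apply: NC.
  exists (cross (Q1 - P) (Q2 - P)), (dot (cross (Q1 - P) (Q2 - P)) P); split=> // Q QS.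
  have : Q \in s0 by [].
  rewrite (perm_mem E13) !in_cons => /or4P[/eqP->//|/eqP->|/eqP->|Qs3].
  - by apply/eqP; rewrite -subr_eq0 -dotNr -dotDr dotC dot_crossl.
  - by apply/eqP; rewrite -subr_eq0 -dotNr -dotDr dotC dot_crossr.
  - apply/eqP; rewrite -subr_eq0 -dotNr -dotDr.
    by apply: contrapT => /negP H'; apply: H; exists Q.
move: Q3s => /perm_to_rem; move: (rem _ _) => s4 E4.
have z4 := perm_size E4; rewrite /= in z4; rewrite z4 in S5.
have [Q4 /perm_to_rem Ps] : exists Q, Q \in s4 by apply: pick1; lia.
move: (rem _ _) Ps => s5 E5.
have z5 := perm_size E5; rewrite /= in z5.
have E : perm_eq s0 (P :: s5 ++ [:: Q4; Q3; Q2; Q1]).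
  apply/permP => p; move/permP/(_ p): E13; move/permP/(_ p): E4; move/permP/(_ p): E5.
  by rewrite /= count_cat /=; lia.
pose L0 := [seq Q - P | Q <- [:: Q4; Q3; Q2; Q1]].
have pL : pairwise (fun h k => cross h k != 0) ([seq Q - P | Q <- s5] ++ L0).
  rewrite -map_cat; apply: pairwise_cross_sphere; last by rewrite -(perm_uniq E).
  by move=> Q; rewrite -(perm_mem E); exact: sph.
(* The four normals of [L0] give 12 = 2 + 2 + 4 + 4 regions; each point of [s5] adds two. *)
have -> : (2 * size s0 + 2 = 12 + 2 * size [seq (Q - P)%R | Q <- s5])%N.
  by rewrite size_map z1 z2 z3 z4 z5; set m := size s5; rewrite !mulnS addnC !addnA.
have P0 Q : Q \in s5 ++ [:: Q4; Q3; Q2; Q1] -> P != Q.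
  move: u0; rewrite (perm_uniq E) /= => /andP[nP _] QQ.
  by apply: contraNneq nP => ->.
apply: (@num_orderings_ge _ S ([seq Q - P | Q <- s5] ++ L0)) => //.
- by rewrite /L0; case: (s5).
- rewrite -map_cat => h /mapP[Q QQ ->]; exists Q, P; split => //.
  + by have : Q \in s0 by rewrite (perm_mem E) in_cons QQ orbT.
  + by have : P \in s0 by rewrite (perm_mem E) mem_head.
  + by rewrite eq_sym P0.
apply: regions_ge_cat => //.
move: pL; rewrite pairwise_cat => /and3P[_ _].
rewrite /L0 /= !andbT => /and3P[/and3P[c43 c42 c41] /andP[c32 c31] c21].
set h1 := Q1 - P in c41 c31 c21 C12 D3 *; set h2 := Q2 - P in c42 c32 c21 C12 D3 *.
set h3 := Q3 - P in c43 c32 c31 D3 *; set h4 := Q4 - P in c43 c42 c41 *.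
have r1 : regions_ge [:: h1] 2 by exact: regions_ge1 (cross_neq0 C12).
have r2 : regions_ge [:: h2; h1] 4.
  by apply: regions_ge_cut2 r1 => // k; rewrite inE => /eqP->.
have r3 : regions_ge [:: h3; h2; h1] 8.
  apply: (regions_ge_cut4 (k1 := h1) (k2 := h2)) r2; rewrite ?inE ?eqxx ?orbT //.
    by rewrite /det3 dotC.
  by move=> k; rewrite !inE => /orP[]/eqP->.
(* Otherwise [h4] is orthogonal to the pairwise cross products of [h1], [h2], [h3]. Their
   determinant is the square of that of [h1], [h2], [h3], so [h4] would be 0. *)
have [k1 [k2 [k1L k2L D]]] : exists k1 k2,
    [/\ k1 \in [:: h3; h2; h1], k2 \in [:: h3; h2; h1] & det3 h4 k1 k2 != 0].
  apply: contrapT => H.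
  have H' k1 k2 : k1 \in [:: h3; h2; h1] -> k2 \in [:: h3; h2; h1] ->
      dot h4 (cross k1 k2) = 0.
    by move=> ? ?; apply/eqP; apply: contrapT => /negP D; apply: H; exists k1, k2.
  have: h4 = 0.
    apply: (@det3_orth _ (cross h1 h2) (cross h2 h3) (cross h3 h1)).
    - have -> : det3 (cross h1 h2) (cross h2 h3) (cross h3 h1) =
        (dot (cross h1 h2) h3) ^+ 2 by rewrite /det3 !(dotE, mxE) /=; ring.
      by rewrite expf_neq0.
    - by apply: H'; rewrite !inE eqxx ?orbT.
    - by apply: H'; rewrite !inE eqxx ?orbT.
    - by apply: H'; rewrite !inE eqxx ?orbT.
  by apply/eqP; exact: cross_neq0 c41.
apply: regions_ge_cut4 D k1L k2L _ r3.
by move=> k; rewrite !inE => /or3P[]/eqP->.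
Qed.

End NonCoplanar.

Section CircleFrame.
Variable R : realType.
Implicit Types (h V W X x y : 'rV[R]_3) (L M : seq 'rV[R]_3) (S : {fset 'rV[R]_3}).

(** * Points on a circle *)

Lemma polar_angle (x y : R) : x ^+ 2 + y ^+ 2 = 1 ->
  exists t, [/\ 0 <= t, t < 2 * pi, cos t = x & sin t = y].
Proof.
move=> xy; have x1 : -1 <= x <= 1 by apply/andP; split; nra.
have cx : cos (acos x) = x by apply: acosK; rewrite in_itv.
have sx : sin (acos x) = `|y|.
  by rewrite sin_acos // -sqrtr_sqr; congr Num.sqrt; lra.
have a0 := acos_ge0 x1; have api := acos_lepi x1; have p0 := pi_gt0 R.
have [y0|y0] := leP 0 y.
  by exists (acos x); split => //; [lra|rewrite sx ger0_norm].
(* This makes the reflected angle [2 * pi - acos x] strictly less than [2 * pi]. *)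
have ax : acos x != 0.
  by apply: contraTneq y0 => e; move: sx; rewrite e sin0 => /esym/eqP; rewrite normr_eq0 => /eqP->; rewrite ltxx.
exists (2 * pi - acos x); split; [lra|by move: ax a0; case: ltrgt0P => // *; lra|..].
- by rewrite -[RHS]cx -(cosN (acos x)) -[RHS]cosD2pi; congr cos; rewrite -(mulr_natl pi); ring.
- by rewrite -[RHS]opprK -(ltr0_norm y0) -sx -sinN -[RHS]sinD2pi; congr sin; rewrite -(mulr_natl pi); ring.
Qed.

(** The difference of the two sides is orthogonal to the basis [a], [u], [cross a u]. *)
Lemma orthonormal_decomp (a u y : 'rV[R]_3) : dot a a = 1 -> dot u u = 1 -> dot a u = 0 ->
  dot y a = 0 -> y = dot y u *: u + dot y (cross a u) *: cross a u.
Proof.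
move=> aa uu au ya; set v := cross a u.
have vv : dot v v = 1 by rewrite dot_cross_self aa uu au; ring.
have av : dot a v = 0 by exact: dot_crossl.
have uv : dot u v = 0 by exact: dot_crossr.
apply/eqP; rewrite -subr_eq0; apply/eqP; apply: (@det3_orth _ a u v).
- have -> : det3 a u v = dot v v by rewrite /det3 !(dotE, mxE) /=; ring.
  by rewrite vv oner_eq0.
- by rewrite dotDl dotNl dotDl !dotZl ya (dotC u) au (dotC v) av; ring.
- by rewrite dotDl dotNl dotDl !dotZl uu (dotC v) uv; ring.
- by rewrite dotDl dotNl dotDl !dotZl uv vv; ring.
Qed.

(** The centre is the foot of the perpendicular from 0 to the plane, [u] points from it to a point
    of the circle, and [v] completes the frame with the unit normal. *)
Lemma circle_frame (a : 'rV[R]_3) (b : R) P Q : a != 0 -> P != Q ->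
  dot P P = 1 -> dot Q Q = 1 -> dot a P = b -> dot a Q = b ->
  exists c u v r, [/\ 0 < r, [/\ dot u u = 1, dot v v = 1 & dot u v = 0] &
    sphere2 (R := R) `&` [set x | dot a x = b] = range (circle_point c u v r)].
Proof.
move=> a0 PQ PP QQ aP aQ.
have aa := dot_gt0 a0; pose N := Num.sqrt (dot a a).
have N0 : 0 < N by rewrite sqrtr_gt0.
have NN : N ^+ 2 = dot a a by rewrite sqr_sqrtr ?ltW.
pose a' := N^-1 *: a; pose b' := b / N.
have aE : a = N *: a' by rewrite scalerA divff ?gt_eqF // scale1r.
have bE : b = N * b' by rewrite mulrC divfK ?gt_eqF.
have a'a' : dot a' a' = 1.
  by rewrite dotZl dotZr -NN; field; rewrite gt_eqF.
clearbody a' b'.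
have planeE x : (dot a x = b) <-> (dot (x - b' *: a') a' = 0).
  rewrite aE bE dotZl dotDl dotNl dotZl a'a' (dotC x) mulr1; split => [|e].
    by move/(mulfI (lt0r_neq0 N0))->; rewrite subrr.
  by congr (N * _); apply/eqP; rewrite -subr_eq0 e.
have normE x : dot x x = 1 -> dot a x = b ->
    dot (x - b' *: a') (x - b' *: a') = 1 - b' ^+ 2.
  move=> xx /planeE; rewrite dotDl dotNl dotZl a'a' (dotC x) mulr1 => /eqP.
  rewrite subr_eq0 => /eqP e.
  by rewrite !(dotDl, dotDr, dotNl, dotNr, dotZl, dotZr) a'a' xx (dotC x) e; ring.
(* As [P != Q], one of them differs from the centre, which makes the radius positive. *)
have [T [TT aT Tc]] : exists T, [/\ dot T T = 1, dot a T = b & T - b' *: a' != 0].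
  have [/subr0_eq Pc|Pc] := eqVneq (P - b' *: a') 0; last by exists P.
  by exists Q; split=> //; rewrite -Pc subr_eq0 eq_sym.
have rr := normE T TT aT; have r0 := dot_gt0 Tc.
have Tperp := (planeE T).1 aT.
move: (T - b' *: a') rr r0 Tperp => w rr r0 wa.
pose r := Num.sqrt (dot w w).
have rp : 0 < r by rewrite sqrtr_gt0.
have rE : r ^+ 2 = dot w w by rewrite sqr_sqrtr ?ltW.
pose u := r^-1 *: w.
have uu : dot u u = 1.
  by rewrite dotZl dotZr -rE; field; rewrite gt_eqF.
have au : dot a' u = 0 by rewrite dotZr dotC wa mulr0.
clearbody u.
have vv : dot (cross a' u) (cross a' u) = 1 by rewrite dot_cross_self a'a' uu au; ring.
have uv : dot u (cross a' u) = 0 by exact: dot_crossr.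
have av : dot a' (cross a' u) = 0 by exact: dot_crossl.
exists (b' *: a'), u, (cross a' u), r; split=> //; apply/seteqP; split=> x /=.
  move=> [xx ax]; have := normE x xx ax; have xa := (planeE x).1 ax.
  set y := x - b' *: a' in xa * => yy.
  have := orthonormal_decomp a'a' uu au xa; move: (cross a' u) vv uv {av} => v vv uv yE.
  have [|t [_ _ ct st]] := @polar_angle (dot y u / r) (dot y v / r).
    have yy2 : dot y y = dot y u ^+ 2 + dot y v ^+ 2.
      by rewrite {2}yE dotDr !dotZr !expr2.
    by rewrite !expr_div_n -mulrDl -yy2 rE rr yy divff // -rr gt_eqF.
  exists t => //; rewrite /circle_point ct st scalerDr !scalerA.
  by rewrite ![r * _]mulrC !divfK ?gt_eqF // -yE addrC subrK.
move=> [t _ <-]; rewrite /circle_point; move: (cross a' u) vv uv av => v vv uv av; split.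
  rewrite /sphere2 /= !(dotDl, dotDr, dotZl, dotZr) a'a' (dotC u a') (dotC v a') (dotC v u).
  rewrite au av uv uu vv; have := cos2Dsin2 t; rewrite rr in rE => cs.
  transitivity (b' ^+ 2 + r ^+ 2 * (cos t ^+ 2 + sin t ^+ 2)); first by ring.
  by rewrite cs rE; ring.
apply/planeE; rewrite addrC addKr dotZl dotDl !dotZl (dotC u a') (dotC v a') au av.
by rewrite !mulr0 addr0 mulr0.
Qed.

End CircleFrame.

(** * Cyclically indexed angles and directions of chords *)

Section Chords.
Variable R : realType.
Implicit Types (h V W X x y : 'rV[R]_3) (L M : seq 'rV[R]_3) (S : {fset 'rV[R]_3}).

Lemma crossZZ (a b : R) x y : cross (a *: x) (b *: y) = (a * b) *: cross x y.
Proof. by apply: rv3P; rewrite !mxE /=; ring. Qed.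

Lemma sinD2pi_nat (x : R) k : sin (x + 2 * pi * k%:R) = sin x.
Proof.
elim: k => [|k IH]; first by rewrite mulr0 addr0.
by rewrite -IH -[RHS]sinD2pi; congr sin; rewrite -(mulr_natl pi) -natr1; ring.
Qed.

Lemma cosD2pi_nat (x : R) k : cos (x + 2 * pi * k%:R) = cos x.
Proof. by rewrite -!sinDpihalf addrAC sinD2pi_nat. Qed.

Lemma circle_pointD2pi_nat (c u v : 'rV[R]_3) (r x : R) k :
  circle_point c u v r (x + 2 * pi * k%:R) = circle_point c u v r x.
Proof. by rewrite /circle_point sinD2pi_nat cosD2pi_nat. Qed.

(* The chord between the parameters [a] and [b] is orthogonal to the
   direction of parameter [(a + b) / 2]. *)
Lemma circle_pointB (c u v : 'rV[R]_3) (r a b : R) :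
  circle_point c u v r a - circle_point c u v r b =
  (2 * r * sin ((a - b) / 2)) *:
    (- sin ((a + b) / 2) *: u + cos ((a + b) / 2) *: v).
Proof.
have [aE bE] : a = (a + b) / 2 + (a - b) / 2 /\ b = (a + b) / 2 - (a - b) / 2.
  by split; field.
move: aE bE; move: ((a + b) / 2) ((a - b) / 2) => p q -> ->.
by rewrite /circle_point cosB cosD sinB sinD; apply: rv3P; rewrite !mxE; ring.
Qed.

Lemma sin_half_neq0 (x : R) : 0 < `|x| < 2 * pi -> sin (x / 2) != 0.
Proof.
have [x0|x0] := leP 0 x; [rewrite ger0_norm //|rewrite ltr0_norm //]; move=> /andP[a b].
  by rewrite gt_eqF // sin_gt0_pi //; apply/andP; split; lra.
by rewrite -oppr_eq0 -sinN gt_eqF // sin_gt0_pi //; apply/andP; split; lra.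
Qed.

Lemma circle_angles (c u v : 'rV[R]_3) (r : R) S (cp := circle_point c u v r) :
  {in S, forall P, exists t, P = cp t} ->
  (0 < #|` S|)%N ->
  exists t : nat -> R,
    [/\ {homo t : i j / (i < j)%N >-> i < j}, forall k, t (k + #|` S|)%N = t k + 2 * pi,
        forall k, cp (t k) \in S &
        {in S, forall P, exists2 k, (k < #|` S|)%N & P = cp (t k)}].
Proof.
set n := #|` S| => SC n0.
have /choice[f Hf] : forall P, exists t, P \in S -> [/\ 0 <= t, t < 2 * pi & P = cp t].
  move=> P; have [PS|PS] := boolP (P \in S); last by exists 0.
  have [t ->] := SC P PS; have [s [s0 s1 cs ss]] := polar_angle (cos2Dsin2 t).
  by exists s; split; rewrite // /cp /circle_point cs ss.
pose s := sort <=%O [seq f P | P <- enum_fset S].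
have sn : size s = n by rewrite size_sort size_map.
have ps : perm_eq s [seq f P | P <- enum_fset S] by rewrite perm_sort.
have us : uniq s.
  rewrite (perm_uniq ps) map_inj_in_uniq ?fset_uniq // => P Q PS QS e.
  by have [_ _ ->] := Hf P PS; have [_ _ ->] := Hf Q QS; rewrite e.
have ls : sorted <%O s by rewrite lt_sorted_uniq_le us sort_le_sorted.
have mS k : (k < n)%N -> [/\ 0 <= s`_k, s`_k < 2 * pi & cp s`_k \in S].
  move=> kn; have : s`_k \in s by rewrite mem_nth // sn.
  rewrite (perm_mem ps) => /mapP[P PS ->].
  by have [? ? <-] := Hf P PS.
pose t k := s`_(k %% n) + 2 * pi * (k %/ n)%:R.
have tE q k : (k < n)%N -> t (q * n + k)%N = s`_k + 2 * pi * q%:R.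
  by move=> kn; rewrite /t modnMDl modn_small // divnMDl // divn_small // addn0.
have kE k : k = (k %/ n * n + k %% n)%N by exact: divn_eq.
have p0 := pi_gt0 R.
exists t; split.
- apply: homo_ltn; first exact: lt_trans.
  move=> k; rewrite (kE k); move: (k %/ n)%N (ltn_pmod k n0) => q; move: (k %% n)%N => m mn.
  rewrite tE //; have [mn1|] := ltnP m.+1 n.
    rewrite -addnS tE // ltrD2r; apply: (sorted_ltn_nth lt_trans) => //.
    + by rewrite inE sn.
    + by rewrite inE sn.
  (* Here the index passes from the last angle of one turn to the first of the next. *)
  move=> mn2; have -> : (q * n + m).+1 = (q.+1 * n + 0)%N by nia.
  rewrite tE // -natr1; have [a _ _] := mS 0%N n0; have [_ b _] := mS m mn; lra.
- move=> k; rewrite {1}(kE k) addnAC -mulSnr tE ?ltn_pmod // -natr1 /t; ring.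
- by move=> k; rewrite /t /cp circle_pointD2pi_nat; have [] := mS (k %% n)%N (ltn_pmod _ _).
- move=> P PS; have : f P \in s by rewrite (perm_mem ps) map_f.
  move/(nthP 0) => [k]; rewrite sn => kn e; exists k => //.
  by rewrite -[k]/(0 * n + k)%N tE // mulr0 addr0 e; have [] := Hf P PS.
Qed.

Section Circle.
Variables (c u v : 'rV[R]_3) (r : R).
Hypotheses (r0 : 0 < r) (uu : dot u u = 1) (vv : dot v v = 1) (uv : dot u v = 0).
Let cp := circle_point c u v r.

Lemma circle_point_neq (a b : R) : 0 < `|a - b| < 2 * pi -> cp a != cp b.
Proof.
move=> ab; rewrite -subr_eq0 circle_pointB scaler_eq0 negb_or.
rewrite !mulf_neq0 ?(gt_eqF r0) ?sin_half_neq0 ?pnatr_eq0 //=.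
rewrite -dot_eq0 !(dotDl, dotDr, dotZl, dotZr) (dotC v u) uu vv uv.
rewrite (_ : _ + _ = cos ((a + b) / 2) ^+ 2 + sin ((a + b) / 2) ^+ 2); last by ring.
by rewrite cos2Dsin2 oner_eq0.
Qed.

(** By [circle_pointB] the cross product is a nonzero multiple of the sine of half the difference of
    the two sums. *)
Lemma cross_chords (a b a' b' : R) : 0 < `|a - b| < 2 * pi -> 0 < `|a' - b'| < 2 * pi ->
  0 < `|(a' + b') - (a + b)| < 2 * pi -> cross (cp a - cp b) (cp a' - cp b') != 0.
Proof.
move=> ab ab' abab'; rewrite !circle_pointB crossZZ.
have -> (x y : R) : cross (- sin x *: u + cos x *: v) (- sin y *: u + cos y *: v) =
    sin (y - x) *: cross u v.
  by apply: rv3P; rewrite sinB !mxE /=; ring.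
rewrite -mulrBl scalerA scaler_eq0 negb_or !mulf_neq0 ?pnatr_eq0 ?sin_half_neq0 ?(gt_eqF r0) //=.
by rewrite -dot_eq0 dot_cross_self uu vv uv expr0n mulr1 subr0 oner_eq0.
Qed.

(** * Counting chord directions by sums of angles *)

Section Chain.
Variables (S : {fset 'rV[R]_3}) (t : nat -> R) (n : nat).
Hypotheses (SS : [set` S] `<=` sphere2 (R := R)) (n5 : (5 <= n)%N).
Hypotheses (tlt : {homo t : i j / (i < j)%N >-> i < j})
  (tper : forall k, t (k + n)%N = t k + 2 * pi) (tS : forall k, cp (t k) \in S).

Let sum (p : nat * nat) : R := t p.1 + t p.2.
(** The two parameters differ by less than a full turn, so the endpoints are distinct. *)
Let chord (p : nat * nat) : bool := (p.1 < p.2 < p.1 + n)%N.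

(** Distinct sums less than [2 * pi] apart give pairwise non-parallel chords, to which
    [regions_ge_pencil] applies. *)
Lemma chords_orderings (ps : seq (nat * nat)) : ps != [::] -> all chord ps ->
  {in ps &, forall p q, sum p - sum q < 2 * pi} -> uniq [seq sum p | p <- ps] ->
  (2 * size ps <= num_orderings S)%N.
Proof.
move=> ps0 /allP pc psm ups.
have cE p : p \in ps -> 0 < `|t p.1 - t p.2| < 2 * pi.
  move/pc => /andP[/tlt p1 /tlt]; rewrite tper => p2.
  by rewrite ltr0_norm ?subr_lt0 //; apply/andP; split; lra.
pose L := [seq cp (t p.1) - cp (t p.2) | p <- ps].
have L0 : L != [::] by rewrite /L; case: (ps) ps0.
rewrite -[size ps](size_map (fun p => cp (t p.1) - cp (t p.2))).
apply: (@num_orderings_ge _ S L) => //.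
- move=> h /mapP[p pps ->]; exists (cp (t p.1)), (cp (t p.2)); split => //.
  exact: circle_point_neq (cE p pps).
apply: regions_ge_pencil => //.
  apply/mapP => -[p /cE/circle_point_neq H /esym/eqP].
  by rewrite subr_eq0 (negPf H).
rewrite pairwise_map; move: (ups); rewrite uniq_pairwise pairwise_map.
apply: (sub_in_pairwise (P := mem ps)); last exact/allP.
move=> p q pp qp /= pq; apply: cross_chords; rewrite ?cE //.
rewrite normr_gt0 subr_eq0 eq_sym pq /= ltr_norml.
by have := psm p q pp qp; have := psm q p qp pp; rewrite /sum => ? ?; apply/andP; split; lra.
Qed.

(** The [n - 1] pairs containing [b], followed by one pair with a still larger sum. *)
Let chain b : seq (nat * nat) :=
  rcons [seq (b, b + k)%N | k <- iota 1 n.-1] (b.+1, b + n.-1)%N.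

Lemma size_chain b : size (chain b) = n.
Proof. by rewrite size_rcons size_map size_iota; lia. Qed.

Lemma chain_chord b : all chord (chain b).
Proof.
rewrite all_rcons; apply/andP; split; first by rewrite /chord /=; lia.
by apply/allP => _ /mapP[k + ->]; rewrite mem_iota /chord /=; lia.
Qed.

Lemma chain_range b : {in chain b, forall p,
  t b + t b.+1 <= sum p < t b + t b.+1 + 2 * pi}.
Proof.
have tle i j : (i <= j)%N -> t i <= t j.
  by rewrite leq_eqVlt => /orP[/eqP->|/tlt/ltW].
move=> p; rewrite mem_rcons in_cons => /orP[/eqP->|/mapP[k + ->]]; rewrite /sum /=.
  have := @tlt b (b + n.-1)%N; have := @tlt (b + n.-1)%N (b + n)%N; rewrite tper.
  by move=> /(_ ltac:(lia)) ? /(_ ltac:(lia)) ?; apply/andP; split; lra.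
rewrite mem_iota => kn; have := @tle b.+1 (b + k)%N; have := @tlt (b + k)%N (b.+1 + n)%N.
by rewrite tper => /(_ ltac:(lia)) ? /(_ ltac:(lia)) ?; apply/andP; split; lra.
Qed.

Lemma chain_uniq b : uniq [seq sum p | p <- chain b].
Proof.
rewrite map_rcons rcons_uniq -map_comp; apply/andP; split.
  apply/mapP => -[k]; rewrite mem_iota /sum /= => kn e.
  have := @tlt b b.+1 (ltnSn _); have [kn1|kn1] := ltnP k n.-1.
    by have := @tlt (b + k)%N (b + n.-1)%N ltac:(lia); lra.
  have E : k = n.-1 by lia.
  by rewrite -E in e; lra.
rewrite map_inj_in_uniq ?iota_uniq // => i j _ _; rewrite /sum /= => /addrI e.
have [ij|ji|//] := ltngtP i j.
- by have := @tlt (b + i)%N (b + j)%N ltac:(lia); rewrite e ltxx.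
- by have := @tlt (b + j)%N (b + i)%N ltac:(lia); rewrite e ltxx.
Qed.

Lemma circle_orderings_ge : (2 * n <= num_orderings S)%N.
Proof.
rewrite -(size_chain 0); apply: chords_orderings.
- by rewrite -size_eq0 size_chain; lia.
- exact: chain_chord.
- by move=> p q /chain_range/andP[? ?] /chain_range/andP[? ?]; lra.
- exact: chain_uniq.
Qed.

(** A sum in this period outside the chain would give [n + 1] chord directions, hence [2 * n + 2]
    orderings. *)
Lemma chain_complete b p : (num_orderings S < 2 * n + 2)%N -> chord p ->
  t b + t b.+1 <= sum p < t b + t b.+1 + 2 * pi ->
  (exists2 k, (0 < k < n)%N & sum p = t b + t (b + k)%N) \/
  sum p = t b.+1 + t (b + n.-1)%N.
Proof.
move=> Sn pc pr; suff : sum p \in [seq sum q | q <- chain b].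
  move=> /mapP[q]; rewrite mem_rcons in_cons => /orP[/eqP->|/mapP[k + ->]] e; first by right.
  by rewrite mem_iota => kn; left; exists k; [lia|].
apply: contraPT Sn => np; apply/negP; rewrite -leqNgt.
have -> : (2 * n + 2 = 2 * size (p :: chain b))%N by rewrite /= size_chain; lia.
have inr q : q \in p :: chain b -> t b + t b.+1 <= sum q < t b + t b.+1 + 2 * pi.
  by rewrite in_cons => /orP[/eqP->//|/chain_range].
apply: chords_orderings => //.
- by rewrite /= pc chain_chord.
- by move=> q q' /inr/andP[? ?] /inr/andP[? ?]; lra.
- by rewrite /= np chain_uniq.
Qed.

(** The gaps after [b] and after [b + 1] are both shown equal to the gap after [b + n - 2]. *)
Lemma equal_gaps b : (num_orderings S < 2 * n + 2)%N ->
  t b.+2 - t b.+1 = t b.+1 - t b.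
Proof.
move=> Sn.
(* Only one term of the chain of [b] can equal the sum of indices [b+1, b+n-2]. *)
have gap2 a : t a.+1 + t (a + n.-2)%N = t a + t (a + n.-1)%N.
  have t1 := @tlt a a.+1 (ltnSn _).
  have t2 := @tlt (a + n.-2)%N (a + n.-1)%N ltac:(lia).
  have t3 := @tlt a (a + n.-2)%N ltac:(lia).
  have t4 := @tlt (a + n.-1)%N (a + n)%N ltac:(lia); rewrite tper in t4.
  have [||[k kn]|] := @chain_complete a (a.+1, a + n.-2)%N Sn.
  - by rewrite /chord /=; lia.
  - by rewrite /sum /=; apply/andP; split; lra.
  - rewrite /sum /= => e; have [kn2|kn2] := leqP k n.-2.
      have : t (a + k)%N <= t (a + n.-2)%N.
        by move: kn2; rewrite leq_eqVlt => /orP[/eqP->//|kn2]; apply/ltW/tlt; lia.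
      lra.
    by rewrite e; congr (_ + t _); lia.
  - by rewrite /sum /= => e; lra.
have g1 := gap2 b; have g2 := gap2 b.+1.
have E1 : (b.+1 + n.-2 = b + n.-1)%N by lia.
have E2 : (b.+1 + n.-1 = b + n)%N by lia.
rewrite E1 E2 tper in g2.
have t0 := @tlt b b.+1 (ltnSn _); have t1 := @tlt b.+1 b.+2 (ltnSn _).
have t2 := @tlt (b + n.-2)%N (b + n.-1)%N ltac:(lia).
have t3 := @tlt b (b + n.-2)%N ltac:(lia).
(* This pair is a chord because [5 <= n]; [g2] bounds its sum within the period. *)
have [||[k kn]|] := @chain_complete b (b.+2, b + n.-2)%N Sn.
- by rewrite /chord /=; lia.
- by rewrite /sum /=; apply/andP; split; lra.
(* Impossible: by [g1] the sums containing [b] are at most [t b.+1 + t (b + n.-2)], which is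
   smaller. *)
- rewrite /sum /= => e.
  have : t (b + k)%N <= t (b + n.-1)%N.
    have : (k <= n.-1)%N by lia.
    by rewrite leq_eqVlt => /orP[/eqP->//|kn2]; apply/ltW/tlt; lia.
  lra.
- by rewrite /sum /= => e; lra.
Qed.

(** The [n] equal gaps in a turn add up to [2 * pi]. *)
Lemma equally_spaced_angles k : (num_orderings S < 2 * n + 2)%N ->
  t k = t 0 + 2 * pi * k%:R / n%:R.
Proof.
move=> Sn; pose g := t 1 - t 0.
have gE b : t b.+1 - t b = g by elim: b => // b <-; exact: equal_gaps.
have tE b : t b = t 0 + g * b%:R.
  elim: b => [|b IH]; first by rewrite mulr0 addr0.
  by rewrite -[t b.+1](subrK (t b)) gE IH -natr1; ring.
have n0 : n%:R != 0 :> R by rewrite pnatr_eq0; lia.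
have := tper 0; rewrite add0n tE => /addrI gn.
by rewrite tE -gn; field.
Qed.

End Chain.
End Circle.

End Chords.

(** * Equally spaced points *)

Section RegularPolygon.
Variable R : realType.
Implicit Types (h V W X x y : 'rV[R]_3) (L M : seq 'rV[R]_3) (S : {fset 'rV[R]_3}).

Lemma sin_sign (q : nat) (x : R) : pi * q%:R < x < pi * q.+1%:R -> 0 < (-1) ^+ q * sin x.
Proof.
elim: q x => [|q IH] x.
  by rewrite mulr0 mulr1 expr0 mul1r; exact: sin_gt0_pi.
move=> H; have -> : (-1) ^+ q.+1 * sin x = (-1) ^+ q * sin (x - pi).
  by rewrite -[in LHS](subrK pi x) sinDpi exprS mulN1r mulrNN.
apply: IH; move: H; rewrite -[q.+2%:R]natr1 -!natr1 => /andP[? ?].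
by apply/andP; split; lra.
Qed.

(** Every residue modulo [n] is a sum of two distinct indices; this produces a tie for each
    direction lying on a bisector. *)
Lemma exists_index_sum (n j : nat) : (5 <= n)%N -> (j < 2 * n)%N ->
  exists k l, [/\ (k < n)%N, (l < n)%N, k != l &
    (k + l = j \/ k + l = j + n \/ k + l + n = j)%N].
Proof.
move=> n5 j2; have [j0|j0] := posnP j.
  by exists 1%N, n.-1; split; lia.
have [jn|nj|jn] := ltngtP j n.
- by exists 0%N, j; split; lia.
- by exists 0%N, (j - n)%N; split; lia.
- by exists 1%N, n.-1; split; lia.
Qed.

Section EquallySpaced.
Variables (c u v : 'rV[R]_3) (r t0 : R) (n : nat).
Hypotheses (r0 : 0 < r) (uu : dot u u = 1) (vv : dot v v = 1) (uv : dot u v = 0).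
Hypothesis n5 : (5 <= n)%N.
Let pt (k : nat) := circle_point c u v r (t0 + 2 * pi * k%:R / n%:R).

Let nr0 : 0 < n%:R :> R.
Proof. by rewrite ltr0n; lia. Qed.

Lemma equally_spaced_neq k l : (k < n)%N -> (l < n)%N -> k != l -> pt k != pt l.
Proof.
move=> kn ln; rewrite neq_ltn; wlog kl : k l kn ln / (k < l)%N.
  by move=> W /orP[kl|lk]; [|rewrite eq_sym]; apply: W; rewrite ?kl ?lk.
move=> _; apply: circle_point_neq => //.
have -> : t0 + 2 * pi * k%:R / n%:R - (t0 + 2 * pi * l%:R / n%:R) =
   - (2 * pi * ((l - k)%N%:R / n%:R)).
  by rewrite natrB 1?ltnW //; field; rewrite gt_eqF.
have p0 := pi_gt0 R; have p2 : 0 < 2 * pi :> R by lra.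
have lk0 : 0 < (l - k)%N%:R / n%:R :> R by rewrite divr_gt0 // ltr0n subn_gt0.
rewrite normrN gtr0_norm; last exact: mulr_gt0.
apply/andP; split; first exact: mulr_gt0.
by rewrite gtr_pMr // ltr_pdivrMr // mul1r ltr_nat; lia.
Qed.

(* [psi] is the angle of [V] in the plane of [u] and [v], measured from [t0]. *)
Lemma dot_equally_spacedB V : (dot V u != 0) || (dot V v != 0) ->
  exists K psi, [/\ 0 < K, 0 <= psi, psi < 2 * pi & forall k l,
    dot V (pt k) - dot V (pt l) =
      K * sin (psi - pi * (k + l)%:R / n%:R) * sin (pi * (k%:R - l%:R) / n%:R)].
Proof.
move=> AB; pose A := dot V u; pose B := dot V v; pose d := Num.sqrt (A ^+ 2 + B ^+ 2).
have dd : 0 < A ^+ 2 + B ^+ 2.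
  case/orP: AB => H.
  - by rewrite ltr_wpDr ?sqr_ge0 // lt_neqAle sqr_ge0 eq_sym expf_neq0.
  - by rewrite ltr_wpDl ?sqr_ge0 // lt_neqAle sqr_ge0 eq_sym expf_neq0.
have d0 : 0 < d by rewrite sqrtr_gt0.
have dE : d ^+ 2 = A ^+ 2 + B ^+ 2 by rewrite sqr_sqrtr // ltW.
have cs := cos2Dsin2 t0.
(* The vector [(A, B)] is normalised and rotated by [- t0]. *)
have [|psi [p1 p2 pc ps]] := @polar_angle _ ((A * cos t0 + B * sin t0) / d) ((B * cos t0 - A * sin t0) / d).
  rewrite !expr_div_n -mulrDl dE.
  transitivity ((A ^+ 2 + B ^+ 2) * (cos t0 ^+ 2 + sin t0 ^+ 2) / (A ^+ 2 + B ^+ 2)).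
    by congr (_ / _); ring.
  by rewrite cs mulr1 divff ?gt_eqF.
have AE : A = d * cos (psi + t0).
  rewrite cosD pc ps; transitivity (A * (cos t0 ^+ 2 + sin t0 ^+ 2)); first by rewrite cs mulr1.
  by field; rewrite gt_eqF.
have BE : B = d * sin (psi + t0).
  rewrite sinD pc ps; transitivity (B * (cos t0 ^+ 2 + sin t0 ^+ 2)); first by rewrite cs mulr1.
  by field; rewrite gt_eqF.
exists (2 * r * d), psi; split=> //; first by rewrite !mulr_gt0.
move=> k l; rewrite -dotNr -dotDr circle_pointB !(dotDr, dotZr) -/A -/B AE BE.
have -> : (t0 + 2 * pi * k%:R / n%:R - (t0 + 2 * pi * l%:R / n%:R)) / 2 =
    pi * (k%:R - l%:R) / n%:R by field; rewrite gt_eqF.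
have -> : (t0 + 2 * pi * k%:R / n%:R + (t0 + 2 * pi * l%:R / n%:R)) / 2 =
    t0 + pi * (k + l)%:R / n%:R by rewrite natrD; field; rewrite gt_eqF.
move: (pi * (k + l)%:R / n%:R) => q.
have -> : psi - q = psi + t0 - (t0 + q) by ring.
by rewrite sinB; ring.
Qed.

(** The ordering depends only on which of the [2 * n] arcs of length [pi / n] contains [psi], so all
    orderings are values of [F] on ['I_(2 * n)]. *)
Lemma equally_spaced_orderings S : [set` S] `<=` sphere2 (R := R) ->
  [set` S] = [set pt k | k in [set k : nat | (k < n)%N]] ->
  (num_orderings S <= 2 * n)%N.
Proof.
have n0 : (0 < n)%N by lia.
move=> SS SE; have p0 := pi_gt0 R.
have ptS k : (k < n)%N -> pt k \in S.
  by move=> kn; have : [set` S] (pt k) by rewrite SE; exists k.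
have /choice[idx idxP] : forall P : S, exists k, (k < n)%N /\ val P = pt k.
  by move=> P; have : [set` S] (val P) by [exact: valP]; rewrite SE => -[k kn <-]; exists k.
(* The power of -1 is the sign of the sine containing [psi]; adding [2 * n], a full turn, keeps the
   natural subtraction from truncating. *)
pose F (j : 'I_(2 * n)) : {set S * S} := [set PQ : S * S |
   0 < (-1) ^+ ((j + 2 * n - (idx PQ.1 + idx PQ.2)) %/ n) *
        sin (pi * ((idx PQ.1)%:R - (idx PQ.2)%:R) / n%:R) :> R]%SET.
rewrite /num_orderings -[leqRHS]card_ord -cardsT; apply: leq_trans (leq_imset_card F _).
apply: subset_leq_card; apply/fintype.subsetP => o; rewrite inE => /asboolP[V [V1 tf ->]].
have neqV k l : (k < n)%N -> (l < n)%N -> k != l -> dot V (pt k) - dot V (pt l) != 0.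
  move=> kn ln kl; rewrite subr_eq0.
  have := tf [` ptS k kn]%fset [` ptS l ln]%fset; rewrite geodist_eq //=; last 2 first.
  - exact/SS/ptS.
  - exact/SS/ptS.
  by apply; rewrite -val_eqE /= equally_spaced_neq.
(* A vantage point orthogonal to [u] and [v] would be equidistant from all points. *)
have [|K [psi [K0 psi0 psi2 dV]]] := @dot_equally_spacedB V.
  rewrite -negb_and; apply: contraL (neqV 0%N 1%N ltac:(lia) ltac:(lia) isT).
  move=> /andP[/eqP A0 /eqP B0]; rewrite negbK -dotNr -dotDr circle_pointB.
  by rewrite !(dotDr, dotZr) A0 B0 !mulr0 addr0 mulr0.
have dV0 k l : (k < n)%N -> (l < n)%N -> k != l -> sin (psi - pi * (k + l)%:R / n%:R) != 0.
  move=> kn ln kl; have := neqV k l kn ln kl; rewrite dV.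
  by apply: contraNneq => ->; rewrite mulr0 mul0r.
pose y := psi * n%:R / pi.
have psiE : psi = pi * y / n%:R by rewrite /y [pi * _]mulrC divfK ?mulfK ?gt_eqF.
have y0 : 0 <= y by rewrite divr_ge0 ?mulr_ge0 // ltW.
have y2 : y < (2 * n)%:R.
  by rewrite ltr_pdivrMr // natrM mulrAC ltr_pM2r.
have [j jy] : exists j : nat, j%:R <= y < j.+1%:R.
  by exists (Num.truncn y); exact: truncn_itv.
have /andP[jy1 jy2] := jy.
have j2n : (j < 2 * n)%N by rewrite -(ltr_nat R); exact: le_lt_trans y2.
(* An integral [y] would put [V] on the bisector of two points with suitable index sum. *)
have jNy : j%:R != y.
  apply/eqP => jE; rewrite -jE in psiE.
  have [k [l [kn ln kl E]]] := exists_index_sum n5 j2n.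
  suff : sin (psi - pi * (k + l)%:R / n%:R) = 0 by move/eqP; rewrite (negPf (dV0 k l kn ln kl)).
  rewrite psiE -mulrBl -mulrBr; case: E => [->|[->|<-]].
  - by rewrite subrr mulr0 mul0r sin0.
  - by rewrite natrD opprD addNKr mulrN mulNr mulfK ?gt_eqF // sinN sinpi oppr0.
  - by rewrite natrD addrAC subrr add0r mulfK ?gt_eqF // sinpi.
apply/imsetP; exists (Ordinal j2n) => //; apply/setP => -[P Q].
rewrite mem_ordering_from // inE /=.
have [[kn ->] [ln ->]] := (idxP P, idxP Q); move: (idx P) (idx Q) kn ln => k l kn ln.
rewrite -subr_gt0 dV.
have kl2 : (k + l <= j + 2 * n)%N.
  by rewrite mul2n -addnn (leq_trans (leq_add (ltnW kn) (ltnW ln))) ?leq_addl.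
pose m := (j + 2 * n - (k + l))%N; rewrite -/m.
(* After a full turn is added, the angle in units of [pi / n] lies strictly between [m] and
   [m + 1]. *)
have sX : 0 < (-1) ^+ (m %/ n) * sin (psi - pi * (k + l)%:R / n%:R).
  rewrite -sinD2pi; apply: sin_sign.
  have mE : j%:R = m%:R + (k + l)%:R - 2 * n%:R :> R.
    apply/eqP; rewrite -subr_eq0 opprD opprK; apply/eqP.
    have -> : m%:R = j%:R + 2 * n%:R - (k + l)%:R :> R.
      by rewrite /m natrB // [in LHS]natrD natrM.
    by ring.
  have XE : psi - pi * (k + l)%:R / n%:R + pi *+ 2 = pi * ((y + 2 * n%:R - (k + l)%:R) / n%:R).
    by rewrite psiE -(mulr_natl pi); field; rewrite gt_eqF.
  rewrite XE !ltr_pM2l // ltr_pdivlMr // ltr_pdivrMr // -!natrM.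
  have jy' : j%:R < y by rewrite lt_neqAle jNy.
  have m1 : (m %/ n * n)%:R <= m%:R :> R by rewrite ler_nat leq_divM.
  have m2 : m.+1%:R <= ((m %/ n).+1 * n)%:R :> R by rewrite ler_nat; exact: ltn_ceil.
  by rewrite -natr1 in jy2; rewrite -natr1 in m2; apply/andP; split; lra.
have {sX} [p pp ->] : exists2 p : R, 0 < p &
    sin (psi - pi * (k + l)%:R / n%:R) = (-1) ^+ (m %/ n) * p.
  by eexists; [exact: sX|rewrite mulrA -expr2 sqrr_sign mul1r].
rewrite (_ : K * _ * _ = (K * p) * ((-1) ^+ (m %/ n) * sin (pi * (k%:R - l%:R) / n%:R))).
  by rewrite pmulr_rgt0 // mulr_gt0.
by ring.
Qed.

End EquallySpaced.

Lemma coplanar_angles S (a : 'rV[R]_3) (b : R) : [set` S] `<=` sphere2 (R := R) ->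
  (2 <= #|` S|)%N -> a != 0 -> {in S, forall P, dot a P = b} ->
  exists c u v r (t : nat -> R),
    [/\ 0 < r, [/\ dot u u = 1, dot v v = 1 & dot u v = 0],
      sphere2 (R := R) `&` [set x | dot a x = b] = range (circle_point c u v r),
      {homo t : i j / (i < j)%N >-> i < j} /\ (forall k, t (k + #|` S|)%N = t k + 2 * pi) &
      (forall k, circle_point c u v r (t k) \in S) /\
      {in S, forall P, exists2 k, (k < #|` S|)%N & P = circle_point c u v r (t k)}].
Proof.
move=> SS S2 a0 SP.
have [P [Q [PS QS PQ]]] : exists P Q, [/\ P \in S, Q \in S & P != Q].
  have : uniq (enum_fset S) by exact: fset_uniq.
  rewrite /= in S2; move: S2 (fun P => erefl (P \in S)).
  rewrite {1}(_ : #|` S| = size (enum_fset S)) //.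
  case E : (enum_fset S) => [//|P [//|Q s]] _ _ /= /andP[].
  rewrite in_cons negb_or => /andP[PQ _] _; exists P, Q; split => //.
  - by change (P \in enum_fset S); rewrite E mem_head.
  - by change (Q \in enum_fset S); rewrite E !in_cons eqxx orbT.
have [c [u [v [r [r0 [uu vv uv] CE]]]]] :=
  circle_frame a0 PQ (SS P PS) (SS Q QS) (SP P PS) (SP Q QS).
have [||t [t1 t2 t3 t4]] := @circle_angles _ c u v r S.
- move=> T TS; have : range (circle_point c u v r) T.
    by rewrite -CE; split; [exact: SS|exact: SP].
  by move=> [t _ <-]; exists t.
- exact: leq_trans S2.
by exists c, u, v, r, t.
Qed.

(** The witness is a regular polygon on the great circle through the first two basis vectors. *)
Lemma exists_equally_spaced (n : nat) : (5 <= n)%N ->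
  exists S, [/\ [set` S] `<=` sphere2 (R := R), #|` S| = n &
    (num_orderings S <= 2 * n)%N].
Proof.
move=> n5; pose u : 'rV[R]_3 := delta_mx 0 0; pose v : 'rV[R]_3 := delta_mx 0 1.
have [uu vv uv] : [/\ dot u u = 1, dot v v = 1 & dot u v = 0].
  by split; rewrite dotE !mxE /=; ring.
pose pt (k : nat) := circle_point 0 u v 1 (0 + 2 * pi * k%:R / n%:R).
pose S := [fset pt (val k) | k in 'I_n]%fset.
have SS : [set` S] `<=` sphere2 (R := R).
  move=> _ /imfsetP[k _ ->]; rewrite /sphere2 /= /pt /circle_point scale1r add0r.
  rewrite !(dotDl, dotDr, dotZl, dotZr) (dotC v u) uu vv uv.
  by move: (0 + _) => x; rewrite -[RHS](cos2Dsin2 x); ring.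
exists S; split=> //.
  rewrite card_imfset /=; first by rewrite -cardE card_ord.
  move=> k l; apply: contra_eq => kl; apply: equally_spaced_neq => //.
apply: (@equally_spaced_orderings 0 u v 1 0 n) => //.
apply/seteqP; split=> [_ /imfsetP[k _ ->]|_ [k kn <-]]; first by exists (val k) => //; exact: ltn_ord.
by apply/imfsetP; exists (Ordinal kn).
Qed.

End RegularPolygon.

(** * The minimum and the sets that attain it *)

Theorem theorem4p4 (R : realType) (n : nat) (hn : (5 <= n)%N) :
  [/\ (forall S : {fset 'rV[R]_3},
         [set` S] `<=` sphere2 (R := R) -> #|` S| = n ->
         (2 * n <= num_orderings S)%N),
      (exists S : {fset 'rV[R]_3},
         [/\ [set` S] `<=` sphere2 (R := R), #|` S| = n &
             num_orderings S = (2 * n)%N]) &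
      (forall S : {fset 'rV[R]_3},
         [set` S] `<=` sphere2 (R := R) -> #|` S| = n ->
         (num_orderings S = (2 * n)%N <->
          exists C : set 'rV[R]_3,
            [/\ is_circle C, [set` S] `<=` C & equally_spaced C S])) ].
Proof.
have lower (S : {fset 'rV[R]_3}) : [set` S] `<=` sphere2 (R := R) -> #|` S| = n ->
    (2 * n <= num_orderings S)%N.
  move=> SS Sn; have [[a [b [a0 ab]]]|NC] :=
    pselect (exists a b, a != 0 /\ {in S, forall P, dot a P = b}); last first.
    by have := noncoplanar_orderings SS _ NC; rewrite Sn => /(_ hn); lia.
  have S2 : (2 <= #|` S|)%N by lia.
  have [c [u [v [r [t [r0 [uu vv uv] CE [t1 t2] [t3 t4]]]]]]] := coplanar_angles SS S2 a0 ab.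
  by rewrite Sn in t2; exact: (circle_orderings_ge r0 uu vv uv SS hn t1 t2 t3).
split=> //.
  have [S [SS Sn S2n]] := exists_equally_spaced R hn.
  by exists S; split => //; apply/eqP; rewrite eqn_leq S2n lower.
move=> S SS Sn; split => [SN|[C [_ _ [c [u [v [r [t0 [r0 [uu vv uv] _ SE]]]]]]]]].
  (* A non-coplanar set would have at least [2 * n + 2] orderings. *)
  have [a [b [a0 ab]]] : exists a b, a != 0 /\ {in S, forall P, dot a P = b}.
    apply: contrapT => NC; have := noncoplanar_orderings SS _ NC.
    by rewrite Sn SN => /(_ hn); lia.
  have S2 : (2 <= #|` S|)%N by lia.
  have [c [u [v [r [t [r0 [uu vv uv] CE [t1 t2] [t3 t4]]]]]]] := coplanar_angles SS S2 a0 ab.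
  exists (sphere2 (R := R) `&` [set x | dot a x = b]); split.
  - by exists a, b.
  - by move=> P PS; split; [exact: SS|exact: ab].
  exists c, u, v, r, (t 0); split=> //.
  rewrite Sn in t2 *; have SN' : (num_orderings S < 2 * n + 2)%N by rewrite SN; lia.
  have tE k := equally_spaced_angles r0 uu vv uv SS hn t1 t2 t3 k SN'.
  apply/seteqP; split=> [P /t4[k]|_ [k _ <-]].
    by rewrite Sn => kn ->; exists k; rewrite // -tE.
  by rewrite -tE; exact: t3.
apply/eqP; rewrite eqn_leq lower // andbT; rewrite Sn in SE.
exact: (equally_spaced_orderings r0 uu vv uv hn SS SE).
Qed.
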